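(* Let $d\ge3$. Let $\omega:\mathbb{R}^d\to\mathbb{R}$ satisfy $0<\delta\le\omega(x)\le1$ for all $x\in \mathbb{R}^d$ and some constant $\delta$, let $\mathcal{Q}$ be a family of cubes in $\mathbb{R}^d$ satisfying condition (G), and assume that there exist $\lambda>0$ and $C>0$ such that $$|\omega(x)-\omega(y)|\le C\left(\frac{|x-y|}{d_Q}\right)^\lambda\qquad\text{for all }Q\in\mathcal{Q},\ x,y\in Q^{**}.$$ Then $\|f\|_{H^1_{at}(\mathcal{A}_{\mathcal{Q}})}\simeq\|f\|_{H^1_{at}(\mathcal{A}_{\omega,\mathcal{Q}})}$, i.e. there is a constant $C'>0$ such that for all $f\in L^1(\mathbb{R}^d)$ $$C'^{-1}\|f\|_{H^1_{at}(\mathcal{A}_{\mathcal{Q}})}\le\|f\|_{H^1_{at}(\mathcal{A}_{\omega,\mathcal{Q}})}\le C'\|f\|_{H^1_{at}(\mathcal{A}_{\mathcal{Q}})}.$$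
   Context: **Cubes.** $Q=Q(c_Q,r_Q)=\{y\in\mathbb{R}^d:\max_i|(c_Q)_i-y_i|<r_Q\}$, with center $c_Q$, radius $r_Q$ and diameter $d_Q=2\sqrt{d}\,r_Q$. For a fixed (small) $\theta>0$, $Q^*=Q(c_Q,(1+\theta)r_Q)$, and $Q^{**}=(Q^* )^*$, $Q^{***}=(Q^{**})^*$, $Q^{****}=(Q^{***})^*$. **Condition (G).** A family of cubes $\mathcal{Q}$ satisfies (G) if there are $C,\theta>0$ such that $\bigcup_{Q\in\mathcal{Q}}\mathrm{cl}(Q)=\mathbb{R}^d$ and, for all $Q_1\ne Q_2$ in $\mathcal{Q}$: $|Q_1\cap Q_2|=0$; and if $Q_1^{****}\cap Q_2^{****}\neq\emptyset$ then $C^{-1}d_{Q_1}\le d_{Q_2}\le Cd_{Q_1}$. **Atomic Hardy space.** For a family $\mathcal{A}\subseteq L^1(\mathbb{R}^d)$ of functions (atoms) with $L^1$-norm at most $1$, $H^1_{at}(\mathcal{A})$ is the set of $f=\sum_{j=1}^\infty\lambda_ja_j$ with $a_j\in\mathcal{A}$, $\lambda_j\in\mathbb{C}$, $\sum_j|\lambda_j|<\infty$, and $\|f\|_{H^1_{at}(\mathcal{A})}$ is the infimum of $\sum_j|\lambda_j|$ over all such representations ($+\infty$ if there is none). **Atoms.** $\mathcal{A}_{\omega,\mathcal{Q}}$ is the set of functions $a$ such that either there are $Q\in\mathcal{Q}$ and a cube $K\subset Q^{**}$ with $\mathrm{supp}\,a\subseteq K$, $\|a\|_\infty\le|K|^{-1}$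 and $\int_Ka(x)\omega(x)\,dx=0$; or $a=|Q|^{-1}\chi_Q$ for some $Q\in\mathcal{Q}$. $\mathcal{A}_{\mathcal{Q}}$ is defined in the same way with the cancellation condition $\int_Ka(x)\,dx=0$ in place of $\int_Ka(x)\omega(x)\,dx=0$. *)

(* Defs.v *)
From HB Require Import structures.
From mathcomp Require Import all_boot all_order all_algebra.
From mathcomp Require Import all_classical all_reals all_analysis.
From mathcomp Require Import ess_sup_inf complex.

Set Implicit Arguments.
Unset Strict Implicit.
Unset Printing Implicit Defensive.

Import Order.TTheory GRing.Theory Num.Theory.
Import numFieldNormedType.Exports.

Local Open Scope classical_set_scope.
Local Open Scope ring_scope.
Local Open Scope complex_scope.

(* R^n is the type ['rV[R]_n] with its library topology. It is given the
   sigma-algebra generated by the n coordinate maps, i.e. the Borel sets. *)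
Definition rV_display : measure_display -> measure_display.
Proof. exact. Qed.

Section measurable_rV.
Context {d : measure_display} {T : measurableType d}.
Variable n : nat.

Let coord : 'I_n -> 'rV[T]_n -> T := fun i x => x ord0 i.

Let rV_set0 : g_sigma_preimage coord set0.
Proof. exact: sigma_algebra0. Qed.

Let rV_setC A : g_sigma_preimage coord A -> g_sigma_preimage coord (~` A).
Proof. exact: sigma_algebraC. Qed.

Let rV_bigcup (F : _^nat) : (forall i, g_sigma_preimage coord (F i)) ->
  g_sigma_preimage coord (\bigcup_i (F i)).
Proof. exact: sigma_algebra_bigcup. Qed.

HB.instance Definition _ := @isMeasurable.Build (rV_display d)
  'rV[T]_n (g_sigma_preimage coord) rV_set0 rV_setC rV_bigcup.

End measurable_rV.

Section lebesgue_rV.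
Variable R : realType.

Definition rV_cons n (p : R * 'rV[R]_n) : 'rV[R]_n.+1 :=
  \row_i oapp (fun j => p.2 ord0 j) p.1 (unlift ord0 i).

Lemma measurable_coord n (i : 'I_n) :
  measurable_fun [set: 'rV[R]_n] (fun x : 'rV[R]_n => x ord0 i).
Proof.
move=> _ Y mY; rewrite setTI; apply: sub_sigma_algebra => /=.
rewrite -bigcup_seq/=; exists i => /=; first by rewrite mem_index_enum.
by exists Y => //; rewrite setTI.
Qed.

Lemma measurable_rVP d (T : measurableType d) n (f : T -> 'rV[R]_n) :
  (forall i, measurable_fun [set: T] (fun x => f x ord0 i)) ->
  measurable_fun [set: T] f.
Proof.
move=> mf.
suff : g_sigma_preimage (fun i x => f x ord0 i) `<=` measurable.
  move=> prefS _ A mA; apply: prefS.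
  rewrite (g_sigma_preimage_comp (fun (i : 'I_n) (x : 'rV[R]_n) => x ord0 i)).
  by exists A.
apply: smallest_sub; first exact: sigma_algebra_measurable.
rewrite -bigcup_seq; apply: bigcup_sub => i _ A [B mB <-].
exact: mf.
Qed.

Lemma measurable_rV_cons n : measurable_fun [set: R * 'rV[R]_n] (@rV_cons n).
Proof.
apply: measurable_rVP => i; under eq_fun do rewrite mxE.
case: unliftP => [j _|_] /=; last exact: measurable_fst.
exact: (measurableT_comp (measurable_coord j) measurable_snd).
Qed.

Section lebesgue_step.
Variables (n : nat) (mu : {sigma_finite_measure set 'rV[R]_n -> \bar R}).

Definition lebesgue_step : set 'rV[R]_n.+1 -> \bar R :=
  pushforward (@lebesgue_measure R \x mu)%E (@rV_cons n).

Let step0 : lebesgue_step set0 = 0%E.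
Proof. by rewrite /lebesgue_step /pushforward preimage_set0 measure0. Qed.

Let step_ge0 A : (0 <= lebesgue_step A)%E.
Proof. exact: (measure_ge0 (@lebesgue_measure R \x mu)%E). Qed.

Let step_sigma_additive : semi_sigma_additive lebesgue_step.
Proof.
have mpre A : measurable A -> measurable (@rV_cons n @^-1` A).
  by move=> mA; rewrite -[X in measurable X]setTI; exact: measurable_rV_cons.
move=> F mF tF mUF; rewrite /lebesgue_step /pushforward preimage_bigcup.
apply: measure_semi_sigma_additive.
- by move=> k; exact: mpre.
- apply/trivIsetP => i j _ _ ij; rewrite -preimage_setI.
  by move/trivIsetP : tF => /(_ _ _ _ _ ij) ->//; rewrite preimage_set0.
- by rewrite -preimage_bigcup; exact: mpre.
Qed.

HB.instance Definition _ := isMeasure.Build _ _ _ lebesgue_step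
  step0 step_ge0 step_sigma_additive.

Let step_sigma_finite : sigma_finite setT lebesgue_step.
Proof.
have /sigma_finiteP[F [TF ndF mF]] := sigma_finiteT (@lebesgue_measure R).
have /sigma_finiteP[G [TG ndG mG]] := sigma_finiteT mu.
pose split (v : 'rV[R]_n.+1) : R * 'rV[R]_n :=
  (v ord0 ord0, \row_j v ord0 (lift ord0 j)).
have msplit : measurable_fun [set: 'rV[R]_n.+1] split.
  apply: measurable_fun_pair; first exact: measurable_coord.
  apply: measurable_rVP => i; under eq_fun do rewrite mxE.
  exact: measurable_coord.
have consK : cancel (@rV_cons n) split.
  move=> [x v]; rewrite /split /rV_cons !mxE unlift_none /=; congr pair.
  by apply/rowP => j; rewrite !mxE liftK.
exists (fun k => split @^-1` (F k `*` G k)).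
  apply/esym; rewrite -subTset => v _.
  have [i _ Fi] : (\bigcup_i F i) (split v).1 by rewrite -TF.
  have [j _ Gj] : (\bigcup_j G j) (split v).2 by rewrite -TG.
  exists (maxn i j) => //; split.
    by move: Fi; exact/subsetPset/ndF/leq_maxl.
  by move: Gj; exact/subsetPset/ndG/leq_maxr.
move=> k; have [mFk Fk] := mF k; have [mGk Gk] := mG k; split.
  rewrite -[X in measurable X]setTI; apply: msplit => //.
  exact: measurableX.
rewrite /lebesgue_step /pushforward -comp_preimage.
rewrite (_ : split \o _ = id) ?preimage_id; last exact/funext.
by rewrite product_measure1E// lte_mul_pinfty// ge0_fin_numE.
Qed.

HB.instance Definition _ := Measure_isSigmaFinite.Build _ _ _ lebesgue_step
  step_sigma_finite.

End lebesgue_step.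

(* Lebesgue measure on the Borel sets of R^n, as the n-fold product of the
   one-dimensional one (the Dirac mass at the only point when n = 0). *)
Fixpoint lebesgue_rV n : {sigma_finite_measure set 'rV[R]_n -> \bar R} :=
  if n is m.+1 return {sigma_finite_measure set 'rV[R]_n -> \bar R}
  then lebesgue_step (lebesgue_rV m)
  else \d_(0 : 'rV[R]_0).

End lebesgue_rV.
Arguments lebesgue_rV {R} n.

Section hardy.
Variables (R : realType) (d : nat).
Local Notation Rd := ('rV[R]_d).
Local Notation mu := (lebesgue_rV d : {measure set 'rV[R]_d -> \bar R}).
Local Notation normc := (@Normc.normc R).

Definition euclid (x : Rd) : R := Num.sqrt (\sum_(i < d) x ord0 i ^+ 2).

(* L^1(R^d) is complex-valued. Its elements are represented by everywhere
   defined Borel functions; no quotient by a.e. equality is taken. *)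
Definition measurableC (f : Rd -> R[i]) : Prop :=
  measurable_fun setT (fun x => complex.Re (f x)) /\
  measurable_fun setT (fun x => complex.Im (f x)).

Definition L1norm (f : Rd -> R[i]) : \bar R := (\int[mu]_x (normc (f x))%:E)%E.

Definition L1 : set (Rd -> R[i]) :=
  [set f | measurableC f /\ (L1norm f < +oo)%E].

Definition integralC (D : set Rd) (f : Rd -> R[i]) : R[i] :=
  Complex (Rintegral mu D (fun x => complex.Re (f x)))
          (Rintegral mu D (fun x => complex.Im (f x))).

Record cube := Cube { center : Rd ; radius : {posnum R} }.

Definition cube_set (Q : cube) : set Rd :=
  [set y | \big[Num.max/0]_(i < d) `|center Q ord0 i - y ord0 i|
           < (radius Q)%:num].

Definition diam (Q : cube) : R := 2 * Num.sqrt d%:R * (radius Q)%:num.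

(* [star theta Q] is Q^*, so [iter k (star theta) Q] is Q with k stars. *)
Definition star (theta : {posnum R}) (Q : cube) : cube :=
  Cube (center Q) ((1 + theta%:num) * (radius Q)%:num)%:pos.

(* [theta] is a parameter, because the dilation constant of condition (G) is
   also the one used in the definition of the atoms. *)
Definition condition_G (theta : {posnum R}) (QQ : set cube) : Prop :=
  exists2 C : R, 0 < C &
    \bigcup_(Q in QQ) closure (cube_set Q) = setT /\
    forall Q1 Q2, QQ Q1 -> QQ Q2 -> Q1 <> Q2 ->
      mu (cube_set Q1 `&` cube_set Q2) = 0%E /\
      (cube_set (iter 4 (star theta) Q1) `&` cube_set (iter 4 (star theta) Q2)
         !=set0 ->
       C^-1 * diam Q1 <= diam Q2 <= C * diam Q1).

(* The series [f = \sum_j lam j a j] converges in L^1. The infimum of the empty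
   set is [+oo]. *)
Definition H1at_norm (A : set (Rd -> R[i])) (f : Rd -> R[i]) : \bar R :=
  ereal_inf [set s : \bar R |
    exists (lam : nat -> R[i]) (a : nat -> Rd -> R[i]),
      [/\ forall j, A (a j),
          s = (\sum_(0 <= j <oo) (normc (lam j))%:E)%E,
          (s < +oo)%E &
          L1norm (fun x => f x - \sum_(0 <= j < n) lam j * a j x)
            @[n --> \oo] --> 0%E]].

Definition supp (a : Rd -> R[i]) : set Rd := closure [set x | a x != 0].

(* [cancellation K a] is the moment condition imposed on an atom [a] supported
   in the cube [K]. *)
Definition atoms_with (cancellation : cube -> (Rd -> R[i]) -> Prop)
    (theta : {posnum R}) (QQ : set cube) : set (Rd -> R[i]) :=
  [set a | L1 a /\
    ((exists2 Q, QQ Q & exists K : cube,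
        [/\ cube_set K `<=` cube_set (iter 2 (star theta) Q),
            supp a `<=` cube_set K,
            (ess_sup mu (fun x => (normc (a x))%:E) <= (mu (cube_set K))^-1)%E &
            cancellation K a]) \/
     (exists2 Q, QQ Q &
        a = fun x => ((fine (mu (cube_set Q)))^-1 * \1_(cube_set Q) x)%:C))].

Definition atoms_weighted (omega : Rd -> R) :=
  atoms_with (fun K a =>
    integralC (cube_set K) (fun x => a x * (omega x)%:C) = 0).

Definition atoms := atoms_with (fun K a => integralC (cube_set K) a = 0).

End hardy.

(* Main.v *)
(* The statement is symmetric in the weights [1] and [omega], so it is enough to
   write an atom [a] for a weight [w1] as a finite combination of atoms for a
   weight [w2] with coefficients of bounded total size.  If [a] lives in
   [K <= Q^**], its [w2]-moment [c] is [O((r_K / r_Q) ^ lambda)] by Hoelder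
   continuity.  Subtracting from [a] the multiple [c] of the [w2]-normalised
   indicator of the half cube of [K] leaves a multiple of an atom; that indicator
   is moved to scale [Q] by successive doublings of the cube, each costing a
   bounded multiple of an atom.  By the geometric growth of [(r_Q / r) ^ lambda]
   along the doublings, the total cost of the displacement is
   [O((r_Q / r_K) ^ lambda)], which the size of [c] compensates. *)
Require Import Defs.
From HB Require Import structures.
From mathcomp Require Import all_boot all_order all_algebra.
From mathcomp Require Import all_classical all_reals all_analysis.
From mathcomp Require Import complex.
From mathcomp Require Import ess_sup_inf measurable_realfun ring lra.

Import Order.TTheory GRing.Theory Num.Theory.
Import numFieldNormedType.Exports.

Local Open Scope classical_set_scope.
Local Open Scope ring_scope.

Set Implicit Arguments.
Unset Strict Implicit.
Unset Printing Implicit Defensive.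

Local Notation center := Defs.center.
Local Notation radius := Defs.radius.
Local Notation normc := Normc.normc.
Local Notation measurableC := Defs.measurableC.

(** * Cubes as open balls of the sup norm *)

Section cube_geometry.
Variables (R : realType) (d : nat).
Implicit Types (Q K L : cube R d) (x y : 'rV[R]_d).

Lemma cube_setP Q x :
  cube_set Q x <-> forall i, `|center Q ord0 i - x ord0 i| < (radius Q)%:num.
Proof.
split=> [/bigmax_ltP[_ h] i|h]; first exact: h.
by apply/bigmax_ltP; split.
Qed.

Lemma cube_center Q : cube_set Q (center Q).
Proof. by apply/cube_setP => i; rewrite subrr normr0. Qed.

Lemma closure_cubeP Q x : closure (cube_set Q) x ->
  forall i, `|center Q ord0 i - x ord0 i| <= (radius Q)%:num.
Proof.
move=> clx i; apply/ler_addgt0Pr => e e0.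
have [y [/cube_setP/(_ i) Qy [_ xy]]] := clx _ (nbhsx_ballx x e e0).
have {}xy := xy ord0 i.
rewrite -(subrKA (y ord0 i)) (le_trans (ler_normD _ _))// ltW// ltrD//.
by rewrite distrC.
Qed.

End cube_geometry.

(** * Measurability and volume of cubes *)

Section cube_measure.
Variable R : realType.

Lemma measurable_box n (c : 'rV[R]_n) (r : R) :
  measurable [set x : 'rV[R]_n | forall i, `|c ord0 i - x ord0 i| < r].
Proof.
rewrite (_ : [set _ | _] = \bigcap_(i in [set: 'I_n])
   ((fun x : 'rV[R]_n => x ord0 i) @^-1` `]c ord0 i - r, c ord0 i + r[%classic)).
  apply: fin_bigcap_measurable; first exact: finite_finset.
  by move=> i _; rewrite -[X in measurable X]setTI; exact: measurable_coord.
apply/seteqP; split=> x /= h i; have := h i.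
  by rewrite ltr_distlC /= in_itv.
by move=> /(_ I)/=; rewrite ltr_distlC in_itv.
Qed.

(** Induction on the dimension: through [rV_cons] a box becomes the product of an interval of length
    [2 * r] and a box of one dimension less. In dimension 0 the Dirac mass gives 1. *)
Lemma lebesgue_box n (c : 'rV[R]_n) (r : R) : 0 < r ->
  lebesgue_rV n [set x : 'rV[R]_n | forall i, `|c ord0 i - x ord0 i| < r] =
    ((2 * r) ^+ n)%:E.
Proof.
move=> r0; elim: n c => [|n IH] c.
  rewrite expr0 /= diracE mem_set//= => i; by case: i.
rewrite /= /lebesgue_step /pushforward.
pose c' : 'rV[R]_n := \row_j c ord0 (lift ord0 j).
rewrite (_ : _ @^-1` _ = `]c ord0 ord0 - r, c ord0 ord0 + r[%classic `*`
   [set x : 'rV[R]_n | forall i, `|c' ord0 i - x ord0 i| < r]); last first.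
  apply/seteqP; split=> -[x v] /=.
    move=> h; split.
      by have := h ord0; rewrite /rV_cons !mxE unlift_none/= in_itv ltr_distlC.
    by move=> i; have := h (lift ord0 i); rewrite /rV_cons !mxE liftK/=.
  move=> [h0 h] i; rewrite /rV_cons !mxE; case: unliftP => [j ->|->]/=.
    by have := h j; rewrite mxE.
  by move: h0; rewrite in_itv ltr_distlC.
rewrite product_measure1E//; last exact: measurable_box.
rewrite IH [X in (X * _)%E]lebesgue_measure_itv/= lte_fin ifT; last by lra.
by rewrite -EFinD -EFinM exprS; congr (_ * _)%:E; lra.
Qed.

Variable d : nat.
Implicit Types (Q : cube R d).

Local Notation mu := (lebesgue_rV d : {measure set 'rV[R]_d -> \bar R}).

Lemma cube_set_box Q : cube_set Q =
  [set x | forall i, `|center Q ord0 i - x ord0 i| < (radius Q)%:num].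
Proof. by apply/seteqP; split=> x /cube_setP. Qed.

Lemma measurable_cube Q : measurable (cube_set Q).
Proof. by rewrite cube_set_box; exact: measurable_box. Qed.

Definition volume Q : R := (2 * (radius Q)%:num) ^+ d.

Lemma lebesgue_cube Q : mu (cube_set Q) = (volume Q)%:E.
Proof. by rewrite cube_set_box; exact: lebesgue_box. Qed.

(* Such a set is the union of the cubes with rational centre and radius [1 / n]
   that it contains. *)
Lemma measurable_of_cubes (U : set 'rV[R]_d) :
  (forall x, U x -> exists e : {posnum R}, cube_set (Cube x e) `<=` U) ->
  measurable U.
Proof.
move=> hU.
have inv_gt0 n : 0 < n.+1%:R^-1 :> R by rewrite invr_gt0.
pose F (p : 'rV[rat]_d * nat) : set 'rV[R]_d :=
  cube_set (Cube (map_mx ratr p.1) (PosNum (inv_gt0 p.2))).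
pose G p : set 'rV[R]_d := if `[< F p `<=` U >] then F p else set0.
rewrite (_ : U = \bigcup_p G p).
  apply: countable_bigcupT_measurable; first exact: countableP.
  by move=> p; rewrite /G; case: ifP => // _; exact: measurable_cube.
apply/seteqP; split=> [x Ux|x [p _]]; last first.
  by rewrite /G; case: asboolP => // FU /FU.
have [e xU] := hU x Ux.
(* Two points of a cube of radius [n.+1%:R^-1] then differ by less than [e] in each coordinate, so a
   rational cube of this radius through [x] stays in [U]. *)
have [n ne] : exists n : nat, n.+1%:R^-1 < e%:num / 2.
  by have /ltr_add_invr[n] : 0 < e%:num / 2 :> R; [|rewrite add0r => h; exists n].
have /choice[q qx] : forall i, exists q : rat, `|ratr q - x ord0 i| < n.+1%:R^-1.
  move=> i; have [q] := @rat_in_itvoo _ (x ord0 i - n.+1%:R^-1) (x ord0 i + n.+1%:R^-1)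
    ltac:(by rewrite ltrD2l gtrN).
  by rewrite in_itv/= => /andP[? ?]; exists q; rewrite ltr_distl; apply/andP.
have Fx : F (\row_i q i, n) x by apply/cube_setP => i; rewrite /= !mxE.
exists (\row_i q i, n) => //; rewrite /G; case: asboolP => //; apply: contra_notP => _ .
move=> y /cube_setP yF; apply: xU; apply/cube_setP => i /=.
have := yF i; have := qx i; rewrite /= !mxE => h1 h2.
rewrite -(subrKA (ratr (q i))) (le_lt_trans (ler_normD _ _))//.
by rewrite distrC; move: ne h1 h2; move: (_^-1) => t; lra.
Qed.

End cube_measure.

(** * Modulus, real and imaginary parts *)

Section complex_norm.
Local Open Scope complex_scope.
Variable R : realType.
Implicit Types (x y : R[i]) (r : R).

Lemma normc_ge0 x : 0 <= normc x.
Proof. by case: x => a b; exact: sqrtr_ge0. Qed.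

Lemma ler_normcD x y : normc (x + y) <= normc x + normc y.
Proof. exact: (@le_normcD R x y). Qed.

Lemma normc_oppr x : normc (- x) = normc x.
Proof. exact: (@normcN R x). Qed.

Lemma normc_real r : normc r%:C = `|r|.
Proof. by rewrite /= expr0n/= addr0 sqrtr_sqr. Qed.

Lemma normr_Re_le x : `|complex.Re x| <= normc x.
Proof.
case: x => a b /=; rewrite -sqrtr_sqr ler_sqrt; last by rewrite addr_ge0 ?sqr_ge0.
by rewrite lerDl sqr_ge0.
Qed.

Lemma normr_Im_le x : `|complex.Im x| <= normc x.
Proof.
case: x => a b /=; rewrite -sqrtr_sqr ler_sqrt; last by rewrite addr_ge0 ?sqr_ge0.
by rewrite lerDr sqr_ge0.
Qed.

Lemma normc_le_ReIm x : normc x <= `|complex.Re x| + `|complex.Im x|.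
Proof.
case: x => a b /=.
rewrite -[leRHS]ger0_norm ?addr_ge0// -sqrtr_sqr ler_sqrt ?sqr_ge0//.
have : 0 <= `|a| * `|b| by rewrite mulr_ge0.
rewrite -[a ^+ 2]real_normK ?num_real// -[b ^+ 2]real_normK ?num_real//.
by move=> ?; nra.
Qed.

Lemma ReD x y : complex.Re (x + y) = complex.Re x + complex.Re y.
Proof. by case: x; case: y. Qed.

Lemma ImD x y : complex.Im (x + y) = complex.Im x + complex.Im y.
Proof. by case: x; case: y. Qed.

Lemma ReM x y : complex.Re (x * y) =
  complex.Re x * complex.Re y - complex.Im x * complex.Im y.
Proof. by case: x; case: y. Qed.

Lemma ImM x y : complex.Im (x * y) =
  complex.Re x * complex.Im y + complex.Im x * complex.Re y.
Proof. by case: x => a b; case: y => c e. Qed.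

End complex_norm.

(** * Complex-valued integrable functions *)

Section complex_L1.
Local Open Scope complex_scope.
Variables (R : realType) (d : nat).
Local Notation mu := (lebesgue_rV d : {measure set 'rV[R]_d -> \bar R}).
Implicit Types (f g : 'rV[R]_d -> R[i]) (c : R[i]) (D : set 'rV[R]_d).

Lemma measurable_normc f : measurableC f ->
  measurable_fun setT (fun x => normc (f x)).
Proof.
move=> [mr mi].
rewrite (_ : (fun _ => _) = Num.sqrt \o
    (fun x => complex.Re (f x) ^+ 2 + complex.Im (f x) ^+ 2)).
  apply: measurableT_comp; first exact: (continuous_measurable_fun (@sqrt_continuous R)).
  by apply: measurable_funD; exact: measurable_funX.
by apply/funext => x /=; case: (f x).
Qed.

Lemma measurableCD f g : measurableC f -> measurableC g ->
  measurableC (fun x => f x + g x).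
Proof.
move=> [fr fi] [gr gi]; split.
  by under eq_fun do rewrite ReD; exact: measurable_funD.
by under eq_fun do rewrite ImD; exact: measurable_funD.
Qed.

Lemma measurableCM f g : measurableC f -> measurableC g ->
  measurableC (fun x => f x * g x).
Proof.
move=> [fr fi] [gr gi]; split.
  by under eq_fun do rewrite ReM; apply: measurable_funB; exact: measurable_funM.
by under eq_fun do rewrite ImM; apply: measurable_funD; exact: measurable_funM.
Qed.

Lemma measurableC_cst c : @Defs.measurableC R d (fun=> c).
Proof. by split; exact: measurable_cst. Qed.

Lemma measurableC_real (w : 'rV[R]_d -> R) : measurable_fun setT w ->
  measurableC (fun x => (w x)%:C).
Proof. by move=> mw; split => //=; exact: measurable_cst. Qed.

Lemma L1normD f g : measurableC f -> measurableC g ->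
  (L1norm (fun x => f x + g x)%R <= L1norm f + L1norm g)%E.
Proof.
move=> mf mg; have mnf := measurable_normc mf; have mng := measurable_normc mg.
rewrite /L1norm -ge0_integralD//=; last 4 first.
- by move=> x _; rewrite lee_fin normc_ge0.
- exact/measurable_EFinP.
- by move=> x _; rewrite lee_fin normc_ge0.
- exact/measurable_EFinP.
apply: ge0_le_integral => //=.
- by move=> x _; rewrite lee_fin normc_ge0.
- by apply/measurable_EFinP; exact: measurable_normc (measurableCD mf mg).
- by apply/measurable_EFinP; exact: measurable_funD.
- by move=> x _; rewrite lee_fin ler_normcD.
Qed.

Lemma L1normZ c f : measurableC f ->
  L1norm (fun x => c * f x) = ((normc c)%:E * L1norm f)%E.
Proof.
move=> mf; have mnf := measurable_normc mf.
rewrite /L1norm -ge0_integralZl//=.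
- by apply: eq_integral => x _; rewrite Normc.normcM EFinM.
- exact/measurable_EFinP.
- by move=> x _; rewrite lee_fin normc_ge0.
- by rewrite lee_fin normc_ge0.
Qed.

Lemma L1norm_ge0 f : (0 <= L1norm f)%E.
Proof. by apply: integral_ge0 => x _; rewrite lee_fin normc_ge0. Qed.

Lemma L1D f g : L1 f -> L1 g -> L1 (fun x => f x + g x).
Proof.
move=> [mf lf] [mg lg]; split; first exact: measurableCD.
by rewrite (le_lt_trans (L1normD mf mg))// lte_add_pinfty.
Qed.

Lemma L1Z c f : L1 f -> L1 (fun x => c * f x).
Proof.
move=> [mf lf]; split; first exact: measurableCM (measurableC_cst c) mf.
rewrite L1normZ//; move: lf (L1norm_ge0 f); case: (L1norm f) => // r _ _.
exact: ltry.
Qed.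

Lemma L1_sum (I : Type) (s : seq I) (F : I -> 'rV[R]_d -> R[i]) :
  (forall i, L1 (F i)) -> L1 (fun x => \sum_(i <- s) F i x).
Proof.
move=> LF; elim: s => [|i s IH].
  under eq_fun do rewrite big_nil; split; first exact: measurableC_cst.
  rewrite /L1norm; under eq_integral do rewrite Normc.normc0.
  by rewrite integral0.
by under eq_fun do rewrite big_cons; exact: L1D.
Qed.

Lemma L1_le f g : measurableC f -> L1 g ->
  (forall x, normc (f x) <= normc (g x)) -> L1 f.
Proof.
move=> mf [mg lg] fg; split => //; apply: le_lt_trans lg.
apply: ge0_le_integral => //=.
- by move=> x _; rewrite lee_fin normc_ge0.
- by apply/measurable_EFinP; exact: measurable_normc.
- by apply/measurable_EFinP; exact: measurable_normc.
- by move=> x _; rewrite lee_fin.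
Qed.

Lemma L1M_bounded f (w : 'rV[R]_d -> R) : measurable_fun setT w ->
  (forall x, `|w x| <= 1) -> L1 f -> L1 (fun x => f x * (w x)%:C).
Proof.
move=> mw w1 [mf lf]; apply: (@L1_le _ f) => //.
  exact: measurableCM (measurableC_real mw).
by move=> x; rewrite Normc.normcM normc_real ler_piMr ?normc_ge0.
Qed.

Lemma L1_integrable_Re f D : measurable D -> L1 f ->
  mu.-integrable D (EFin \o (fun x => complex.Re (f x))).
Proof.
move=> mD [[fr fi] lf]; apply: (@integrableS _ _ _ _ setT) => //.
apply/integrableP; split; first by apply/measurable_EFinP.
apply: le_lt_trans lf; apply: ge0_le_integral => //=.
- by apply/measurable_EFinP; exact: measurableT_comp.
- by apply/measurable_EFinP; exact: measurable_normc.
- by move=> x _; rewrite lee_fin normr_Re_le.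
Qed.

Lemma L1_integrable_Im f D : measurable D -> L1 f ->
  mu.-integrable D (EFin \o (fun x => complex.Im (f x))).
Proof.
move=> mD [[fr fi] lf]; apply: (@integrableS _ _ _ _ setT) => //.
apply/integrableP; split; first by apply/measurable_EFinP.
apply: le_lt_trans lf; apply: ge0_le_integral => //=.
- by apply/measurable_EFinP; exact: measurableT_comp.
- by apply/measurable_EFinP; exact: measurable_normc.
- by move=> x _; rewrite lee_fin normr_Im_le.
Qed.

Lemma integralCD D f g : measurable D -> L1 f -> L1 g ->
  integralC D (fun x => f x + g x) = integralC D f + integralC D g.
Proof.
move=> mD Lf Lg; rewrite /integralC /=.
under eq_Rintegral do rewrite ReD.
under [X in Complex _ X]eq_Rintegral do rewrite ImD.
rewrite !RintegralD//; [exact: L1_integrable_Im..|exact: L1_integrable_Re|].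
exact: L1_integrable_Re.
Qed.

Lemma integralCZ D c f : measurable D -> L1 f ->
  integralC D (fun x => c * f x) = c * integralC D f.
Proof.
move=> mD Lf; have iR := L1_integrable_Re mD Lf; have iI := L1_integrable_Im mD Lf.
rewrite /integralC /=.
under eq_Rintegral do rewrite ReM.
under [X in Complex _ X]eq_Rintegral do rewrite ImM.
have iZ r (h : 'rV[R]_d -> R) : mu.-integrable D (EFin \o h) ->
    mu.-integrable D (EFin \o (fun x => r * h x)).
  by move=> ih; exact: (integrableZl mD r ih).
rewrite RintegralB ?RintegralD//; try exact: iZ.
by rewrite !RintegralZl//; case: c.
Qed.

(** Real and imaginary parts are bounded separately by the modulus, whence the factor 2. *)
Lemma normc_integralC D f : measurable D -> L1 f ->
  ((normc (integralC D f))%:E <= 2%:E * \int[mu]_(x in D) (normc (f x))%:E)%E.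
Proof.
move=> mD Lf; have [mf lf] := Lf.
have iR := L1_integrable_Re mD Lf; have iI := L1_integrable_Im mD Lf.
have mn : measurable_fun D (fun x => (normc (f x))%:E).
  by apply/measurable_EFinP/measurable_funTS; exact: measurable_normc.
have -> : 2%:E = (1%:E + 1%:E)%E :> \bar R by rewrite -EFinD.
rewrite ge0_muleDl// !mul1e.
apply: (@le_trans _ _ (`|\int[mu]_(x in D) complex.Re (f x)|%:E
    + `|\int[mu]_(x in D) complex.Im (f x)|%:E)%E).
  by rewrite -EFinD lee_fin; exact: normc_le_ReIm.
apply: leeD.
  rewrite EFin_normr_Rintegral//; apply: le_trans (le_abse_integral _ _ _) _ => //.
    by case/integrableP : iR.
  apply: ge0_le_integral => //=.
  - by apply/measurable_EFinP/measurable_funTS; apply: measurableT_comp => //; case: mf.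
  - by move=> x _; rewrite lee_fin normr_Re_le.
rewrite EFin_normr_Rintegral//; apply: le_trans (le_abse_integral _ _ _) _ => //.
  by case/integrableP : iI.
apply: ge0_le_integral => //=.
- by apply/measurable_EFinP/measurable_funTS; apply: measurableT_comp => //; case: mf.
- by move=> x _; rewrite lee_fin normr_Im_le.
Qed.

End complex_L1.

(** * Inclusions between cubes *)

Section cube_inclusions.
Variables (R : realType) (d : nat).
Implicit Types (G K L Q : cube R d).

Lemma volume_gt0 Q : 0 < volume Q.
Proof. by rewrite exprn_gt0// mulr_gt0. Qed.

(** Cubes are open and the support of an atom is closed, so indicators are placed on half cubes,
    whose closure stays inside the cube. *)
Definition half_cube K : cube R d := Cube (center K) ((radius K)%:num / 2)%:pos.

Lemma volume_half K : volume K = 2 ^+ d * volume (half_cube K).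
Proof. by rewrite /volume /= -exprMn; congr (_ ^+ _); field. Qed.

Lemma le_volume (k : R) G L : (radius L)%:num <= k * (radius G)%:num ->
  volume L <= k ^+ d * volume G.
Proof.
move=> h; have rL : 0 < (radius L)%:num by [].
by rewrite /volume -exprMn lerXn2r ?nnegrE//; lra.
Qed.

Lemma cube_sub G L : (forall i, `|center L ord0 i - center G ord0 i| <=
    (radius L)%:num - (radius G)%:num) -> cube_set G `<=` cube_set L.
Proof.
move=> h x /cube_setP Gx; apply/cube_setP => i.
rewrite -(subrKA (center G ord0 i)) (le_lt_trans (ler_normD _ _))//.
by have := h i; have := Gx i; lra.
Qed.

Lemma closure_cube_sub G L : (forall i, `|center L ord0 i - center G ord0 i| <
    (radius L)%:num - (radius G)%:num) -> closure (cube_set G) `<=` cube_set L.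
Proof.
move=> h x /closure_cubeP Gx; apply/cube_setP => i.
rewrite -(subrKA (center G ord0 i)) (le_lt_trans (ler_normD _ _))//.
by have := h i; have := Gx i; lra.
Qed.

Lemma closure_half_cube K : closure (cube_set (half_cube K)) `<=` cube_set K.
Proof.
apply: closure_cube_sub => i /=; rewrite subrr normr0.
by have : 0 < (radius K)%:num by []; lra.
Qed.

(** The inclusion is tested on a point of [G] close to a vertex, on the side away from the centre of
    [L] in the coordinate [i]; the error [e] is arbitrary. *)
Lemma cube_sub_inv G L : cube_set G `<=` cube_set L ->
  forall i, `|center L ord0 i - center G ord0 i| <=
    (radius L)%:num - (radius G)%:num.
Proof.
move=> GL i; rewrite lerBrDr; apply/ler_addgt0Pr => e e0.
have rG : 0 < (radius G)%:num by [].
pose s : R := if center L ord0 i <= center G ord0 i then 1 else -1.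
have s1 : `|s| = 1 by rewrite /s; case: ifP; rewrite ?normrN normr1.
(* The maximum with 0 keeps [y] in [G] even when [e] exceeds the radius. *)
pose t := Num.max 0 ((radius G)%:num - e).
pose y : 'rV[R]_d := \row_j (center G ord0 j + s * t).
have Gy : cube_set G y.
  apply/cube_setP => j; rewrite mxE.
  rewrite opprD addrA subrr add0r normrN normrM s1 mul1r ger0_norm.
    by rewrite gt_max rG/=; lra.
  by rewrite le_max lexx.
have /cube_setP/(_ i) := GL _ Gy; rewrite mxE => h.
have : t >= (radius G)%:num - e by rewrite le_max lexx orbT.
have t0 : 0 <= t by rewrite le_max lexx.
move: h; rewrite /s; case: ifPn => [lc|]; last rewrite -ltNge => lc.
  rewrite mul1r ler0_norm; last lra.
  by rewrite ler0_norm; lra.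
rewrite mulN1r ger0_norm; last lra.
by rewrite ger0_norm; lra.
Qed.

End cube_inclusions.

(** * Finite combinations with bounded total coefficient *)

Section decompositions.
Local Open Scope complex_scope.
Variables (R : realType) (T : Type).
Implicit Types (A : set (T -> R[i])) (f g : T -> R[i]) (B : R).

(** The list is nonempty so that, when the lists attached to the terms of a series are concatenated,
    the first [n] of them supply at least [n] terms. *)
Definition decomposes A B f := exists l : seq (R[i] * (T -> R[i])),
  [/\ l != [::], (forall p, p \in l -> A p.2), \sum_(p <- l) normc p.1 <= B &
      f = fun x => \sum_(p <- l) p.1 * p.2 x].

Lemma decomposes_le A B B' f : B <= B' -> decomposes A B f -> decomposes A B' f.
Proof. by move=> BB' [l [? ? h ?]]; exists l; split => //; exact: le_trans BB'. Qed.

Lemma decomposes1 A c f : A f -> decomposes A (normc c) (fun x => c * f x).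
Proof.
move=> Af; exists [:: (c, f)]; split => //.
- by move=> p; rewrite inE => /eqP ->.
- by rewrite big_seq1.
- by apply/funext => x; rewrite big_seq1.
Qed.

Lemma decomposesD A B B' f g : decomposes A B f -> decomposes A B' g ->
  decomposes A (B + B') (fun x => f x + g x).
Proof.
move=> [l [l0 Al lB ->]] [m [m0 Am mB ->]]; exists (l ++ m); split.
- by case: l l0 {Al lB}.
- by move=> p; rewrite mem_cat => /orP[/Al|/Am].
- by rewrite big_cat/= lerD.
- by apply/funext => x; rewrite big_cat.
Qed.

Lemma decomposesZ A B c f : decomposes A B f ->
  decomposes A (normc c * B) (fun x => c * f x).
Proof.
move=> [l [l0 Al lB ->]]; exists [seq (c * p.1, p.2) | p <- l]; split.
- by case: l l0 {Al lB}.
- by move=> _ /mapP[p /Al Ap ->].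
- rewrite big_map/=; under eq_bigr do rewrite Normc.normcM.
  by rewrite -mulr_sumr ler_wpM2l ?normc_ge0.
- apply/funext => x; rewrite big_map mulr_sumr; apply: eq_bigr => p _ /=.
  by rewrite mulrA.
Qed.

End decompositions.

(** * Atoms for a weight bounded below *)

Section weighted_atoms.
Local Open Scope complex_scope.
Variables (R : realType) (d : nat) (delta : R) (w : 'rV[R]_d -> R).
Hypotheses (delta_gt0 : 0 < delta) (mw : measurable_fun setT w).
Hypothesis w_bounds : forall x, delta <= w x <= 1.
Variables (theta : {posnum R}) (QQ : set (cube R d)).
Implicit Types (G K L Q : cube R d) (f g : 'rV[R]_d -> R[i]).
Local Notation mu := (lebesgue_rV d : {measure set 'rV[R]_d -> \bar R}).
Local Notation AA := (atoms_weighted w theta QQ).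

Lemma weight_gt0 x : 0 < w x.
Proof. by have /andP[+ _] := w_bounds x; exact: lt_le_trans. Qed.

Lemma weight_norm_le1 x : `|w x| <= 1.
Proof. by rewrite gtr0_norm ?weight_gt0//; have /andP[] := w_bounds x. Qed.

Lemma integrable_weight G : mu.-integrable (cube_set G) (EFin \o w).
Proof.
apply: measurable_bounded_integrable; first exact: measurable_cube.
- by rewrite lebesgue_cube ltry.
- exact: measurable_funTS.
- exists 1; split => // M M1 x _ /=.
  exact: le_trans (weight_norm_le1 x) (ltW M1).
Qed.

Definition mass G : R := \int[mu]_(x in cube_set G) w x.

Lemma integrable_cst_cube G (r : R) :
  mu.-integrable (cube_set G) (EFin \o (fun=> r)).
Proof.
apply: measurable_bounded_integrable; first exact: measurable_cube.
- by rewrite lebesgue_cube ltry.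
- exact: measurable_cst.
- exists `|r|; split => // M M1 x _ /=; exact: ltW.
Qed.

Lemma mass_ge G : delta * volume G <= mass G.
Proof.
have -> : delta * volume G = \int[mu]_(x in cube_set G) delta.
  by rewrite Rintegral_cst ?lebesgue_cube//; exact: measurable_cube.
apply: le_Rintegral; first exact: measurable_cube.
- exact: integrable_cst_cube.
- exact: integrable_weight.
- by move=> x _; have /andP[] := w_bounds x.
Qed.

Lemma mass_gt0 G : 0 < mass G.
Proof. by apply: lt_le_trans (mass_ge G); rewrite mulr_gt0// volume_gt0. Qed.

Lemma invmass_le G : (mass G)^-1 <= (delta * volume G)^-1.
Proof. by rewrite lef_pV2 ?posrE ?mass_gt0 ?mulr_gt0 ?volume_gt0 ?mass_ge. Qed.

Lemma volume_mass_le G : volume G / mass G <= delta^-1.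
Proof.
rewrite ler_pdivrMr ?mass_gt0// mulrC ler_pdivlMr// mulrC; exact: mass_ge.
Qed.

Lemma L1_indic G : L1 (fun x => (\1_(cube_set G) x)%:C).
Proof.
have mG := measurable_cube G; split; first exact: measurableC_real.
rewrite /L1norm; under eq_integral do rewrite normc_real ger0_norm//.
by rewrite integral_indic// setIT lebesgue_cube ltry.
Qed.

(** The normalisation gives every bump the moment 1 against [w], so that the difference of two bumps
    has moment 0. *)
Definition bump G (x : 'rV[R]_d) : R[i] := ((mass G)^-1 * \1_(cube_set G) x)%:C.

Lemma L1_bump G : L1 (bump G).
Proof.
have -> : bump G = fun x => (mass G)^-1%:C * (\1_(cube_set G) x)%:C.
  by apply/funext => x; rewrite /bump rmorphM.
exact/L1Z/L1_indic.
Qed.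

Lemma normc_bump_le G x : normc (bump G x) <= (delta * volume G)^-1.
Proof.
have m0 : 0 <= (mass G)^-1 by rewrite invr_ge0 ltW// mass_gt0.
rewrite normc_real ger0_norm ?mulr_ge0// (le_trans _ (invmass_le G))//.
by rewrite ler_piMr//; rewrite indicE; case: (_ \in _).
Qed.

Lemma bump_neq0 G : [set x | bump G x != 0] `<=` cube_set G.
Proof.
move=> x /=; rewrite /bump indicE; case: (boolP (x \in cube_set G)) => [/set_mem//|_].
by rewrite mulr0 eqxx.
Qed.

Definition moment L f : R[i] := integralC (cube_set L) (fun x => f x * (w x)%:C).

Lemma momentD L f g : L1 f -> L1 g ->
  moment L (fun x => f x + g x) = moment L f + moment L g.
Proof.
move=> Lf Lg; rewrite /moment -integralCD; [|exact: measurable_cube|..].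
- by congr (integralC _ _); apply/funext => x; rewrite mulrDl.
- exact: L1M_bounded mw weight_norm_le1 Lf.
- exact: L1M_bounded mw weight_norm_le1 Lg.
Qed.

Lemma momentZ L c f : L1 f -> moment L (fun x => c * f x) = c * moment L f.
Proof.
move=> Lf; rewrite /moment -integralCZ; [|exact: measurable_cube|].
- by congr (integralC _ _); apply/funext => x; rewrite mulrA.
- exact: L1M_bounded mw weight_norm_le1 Lf.
Qed.

Lemma moment_bump G L : cube_set G `<=` cube_set L -> moment L (bump G) = 1.
Proof.
move=> GL; rewrite /moment /integralC /bump.
have -> : Rintegral mu (cube_set L) (fun x => complex.Im
    (((mass G)^-1 * \1_(cube_set G) x)%:C * (w x)%:C)) = 0.
  under eq_Rintegral do rewrite -rmorphM/=.
  by rewrite Rintegral_cst ?mul0r//; exact: measurable_cube.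
have -> : Rintegral mu (cube_set L) (fun x => complex.Re
    (((mass G)^-1 * \1_(cube_set G) x)%:C * (w x)%:C)) =
    Rintegral mu (cube_set L `&` cube_set G) (fun x => (mass G)^-1 * w x).
  rewrite Rintegral_mkcondr; apply: eq_Rintegral => x _.
  rewrite -rmorphM/= patchE indicE.
  by case: (x \in cube_set G); rewrite ?mulr1 ?mulr0 ?mul0r.
rewrite setIidr// RintegralZl//; [|exact: measurable_cube|exact: integrable_weight].
by rewrite mulVf ?gt_eqF ?mass_gt0.
Qed.

(** A bump on [Q] itself is the indicator atom of [Q] times [volume Q / mass Q], which is at most
    [delta^-1] because [w >= delta]. *)
Lemma decomposes_bump Q : QQ Q -> decomposes AA delta^-1 (bump Q).
Proof.
move=> QQQ; have vQ := volume_gt0 Q; have mQ := mass_gt0 Q.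
pose a : 'rV[R]_d -> R[i] :=
  fun x => ((fine (mu (cube_set Q)))^-1 * \1_(cube_set Q) x)%:C.
have La : L1 a.
  have -> : a = fun x => (fine (mu (cube_set Q)))^-1%:C * (\1_(cube_set Q) x)%:C.
    by apply/funext => x; rewrite /a rmorphM.
  exact/L1Z/L1_indic.
have Aa : AA a by split => //; right; exists Q.
have -> : bump Q = fun x => (volume Q / mass Q)%:C * a x.
  apply/funext => x; rewrite /a /bump lebesgue_cube -rmorphM/=; congr _%:C.
  by rewrite mulrA; congr (_ * _); rewrite mulrAC divff ?mul1r ?gt_eqF.
apply: decomposes_le (decomposes1 _ Aa).
rewrite normc_real ger0_norm; first exact: volume_mass_le.
by rewrite divr_ge0 ?ltW.
Qed.

(** A single term is enough: [B^-1 * f] is an atom supported in [L]. *)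
Lemma decomposes_cancelling (f : 'rV[R]_d -> R[i]) (B : R) Q L : QQ Q ->
  cube_set L `<=` cube_set (iter 2 (star theta) Q) -> 0 < B -> L1 f ->
  supp f `<=` cube_set L ->
  (\forall x \ae mu, normc (f x) <= B / volume L) ->
  moment L f = 0 -> decomposes AA B f.
Proof.
move=> QQQ LQ B0 Lf sf fB f0.
have -> : f = fun x => B%:C * (B^-1%:C * f x).
  by apply/funext => x; rewrite mulrA -rmorphM/= divff ?gt_eqF// mul1r.
suff Af : AA (fun x => B^-1%:C * f x).
  by apply: decomposes_le (decomposes1 _ Af); rewrite normc_real gtr0_norm.
split; first exact: L1Z.
left; exists Q => //; exists L; split => //.
- apply: subset_trans sf; apply: closure_subset => x /=.
  by apply: contra_neq => ->; rewrite mulr0.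
- apply/ess_supP; apply: filterS fB => x fB.
  rewrite lebesgue_cube inver gt_eqF ?volume_gt0// lee_fin.
  rewrite Normc.normcM normc_real gtr0_norm ?invr_gt0//.
  by rewrite ler_pdivrMl// .
- by rewrite -[LHS]/(moment L _) momentZ// f0 mulr0.
Qed.

(** One move of the chain. The two moments cancel, and each bump is at most [(k / delta) / volume L]
    in modulus because its cube fills at least the proportion [1 / k] of [L]. *)
Lemma decomposes_bumpB (k : R) Q L G G' : QQ Q ->
  cube_set L `<=` cube_set (iter 2 (star theta) Q) ->
  closure (cube_set G) `<=` cube_set L -> closure (cube_set G') `<=` cube_set L ->
  volume L <= k * volume G -> volume L <= k * volume G' ->
  decomposes AA (2 * k / delta) (fun x => bump G x + -1 * bump G' x).
Proof.
move=> QQQ LQ GL G'L kG kG'.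
have vL := volume_gt0 L; have vG := volume_gt0 G; have vG' := volume_gt0 G'.
have k0 : 0 < k by rewrite -(pmulr_lgt0 _ vG) (lt_le_trans vL).
have bump_le H x : volume L <= k * volume H ->
    normc (bump H x) <= (k / delta) / volume L.
  move=> kH; apply: le_trans (normc_bump_le H x) _; have vH := volume_gt0 H.
  rewrite invfM -[k / delta]mulrC -mulrA ler_pM2l ?invr_gt0//.
  by rewrite ler_pdivlMr// ler_pdivrMl// mulrC.
apply: (@decomposes_cancelling _ _ Q L) => //.
- by rewrite !mulr_gt0// invr_gt0.
- by apply: L1D; [|apply: L1Z]; exact: L1_bump.
- rewrite /supp; apply: (@subset_trans _ (closure (cube_set G `|` cube_set G'))).
    apply: closure_subset => x /= ne0; 
    have [|/negPn/eqP G0] := boolP (bump G x != 0); first by move/bump_neq0; left.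
    right; apply: bump_neq0; apply: contra_neq ne0 => G'0.
    by rewrite G0 G'0 mulr0 addr0.
  by rewrite closureU subUset.
- apply: nearW => x; apply: le_trans (ler_normcD _ _) _.
  rewrite Normc.normcM normc_oppr Normc.normc1 mul1r.
  have := bump_le G x kG; have := bump_le G' x kG'.
  by rewrite -!mulrA; lra.
- rewrite momentD ?momentZ ?moment_bump; [by rewrite mulN1r subrr|..].
  + exact: subset_trans (@subset_closure _ _) G'L.
  + exact: subset_trans (@subset_closure _ _) GL.
  + exact: L1_bump.
  + exact: L1_bump.
  + exact/L1Z/L1_bump.
Qed.

End weighted_atoms.

(** * Moving an indicator up to the scale of [Q] *)

Section chain.
Local Open Scope complex_scope.
Variables (R : realType) (d : nat) (delta lambda : R) (w : 'rV[R]_d -> R).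
Hypotheses (delta_gt0 : 0 < delta) (mw : measurable_fun setT w).
Hypotheses (w_bounds : forall x, delta <= w x <= 1) (lambda_gt0 : 0 < lambda).
Hypothesis d_gt0 : (0 < d)%N.
Variables (theta : {posnum R}) (QQ : set (cube R d)).
Implicit Types (G K L Q : cube R d).
Local Notation AA := (atoms_weighted w theta QQ).
Local Notation "Q ^**" := (iter 2 (star theta) Q) (at level 2).

(** One volume ratio for all moves: a half cube of [K] against a cube of at most twice the radius of
    [K] accounts for the 4, and [Q] against [Q^**] for [(1 + theta) ^+ 2]. *)
Definition chain_ratio : R := (4 * (1 + theta%:num) ^+ 2) ^+ d.
(** The term [2 * chain_ratio / delta] pays for one difference of bumps, and the extra [1 / delta]
    for the bump on [Q] that ends the chain. *)
Definition chain_step : R := (2 * chain_ratio + 1) / delta.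
(** The sum of the geometric series with first term [chain_step] and ratio [2 ^ (- lambda)]. *)
Definition chain_cost : R := chain_step / (1 - 2 `^ (- lambda)).

Lemma chain_ratio_gt0 : 0 < chain_ratio.
Proof. by rewrite exprn_gt0// mulr_gt0// exprn_gt0// addr_gt0. Qed.

Lemma chain_step_gt0 : 0 < chain_step.
Proof. by have := chain_ratio_gt0 => k0; rewrite divr_gt0//; lra. Qed.

Lemma pow2N_lt1 : 2 `^ (- lambda) < 1 :> R.
Proof.
rewrite powRN invf_lt1 ?powR_gt0//.
have /(_ 1 2) := gt0_ltr_powR lambda_gt0.
by rewrite powR1; apply; rewrite ?nnegrE// ltr1n.
Qed.

Lemma chain_cost_gt0 : 0 < chain_cost.
Proof. by rewrite divr_gt0 ?chain_step_gt0// subr_gt0 pow2N_lt1. Qed.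

Lemma radius_star2 Q : (radius Q^**)%:num = (1 + theta%:num) ^+ 2 * (radius Q)%:num.
Proof. by rewrite /= expr2 mulrA. Qed.

Lemma closure_cube_star2 Q : closure (cube_set Q) `<=` cube_set Q^**.
Proof.
apply: closure_cube_sub => i; rewrite radius_star2 /= subrr normr0.
by have : 0 < theta%:num by []; have : 0 < (radius Q)%:num by []; nra.
Qed.

Lemma radius_le_star2 K Q : cube_set K `<=` cube_set Q^** ->
  (radius K)%:num <= (radius Q^**)%:num.
Proof.
(* The inclusion is read on one coordinate, which exists since [d > 0]. *)
move=> /cube_sub_inv/(_ (Ordinal d_gt0)); rewrite -subr_ge0.
exact: le_trans (normr_ge0 _).
Qed.

(* The centre moves towards that of [L] so that the doubled cube stays in [L]. *)
Lemma double_cube K L : cube_set K `<=` cube_set L ->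
  2 * (radius K)%:num <= (radius L)%:num ->
  exists K', [/\ (radius K')%:num = 2 * (radius K)%:num,
    cube_set K' `<=` cube_set L &
    forall i, `|center K' ord0 i - center K ord0 i| <= (radius K)%:num].
Proof.
move=> /cube_sub_inv KL rKL.
have r0 : 0 < (radius K)%:num by [].
set r := (radius K)%:num in KL rKL r0 *; set P := (radius L)%:num in KL rKL *.
have Pr : 0 < P - r by lra.
(* As [u * (P - r) = r], the centre moves by at most [r], and its remaining distance to the centre
   of [L] is at most [(1 - u) * (P - r) = P - 2 * r], exactly the room that the doubled cube
   needs. *)
pose u := r / (P - r).
have uPr : u * (P - r) = r by rewrite /u mulfVK// gt_eqF.
have u0 : 0 <= u by rewrite divr_ge0 ?ltW.
have u1 : u <= 1 by rewrite ler_pdivrMr//; lra.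
exists (Cube (\row_i (center K ord0 i + u * (center L ord0 i - center K ord0 i)))
             (2 * (radius K)%:num)%:pos); split => //.
- apply: cube_sub => i; rewrite /= mxE -/P opprD addrA.
  rewrite -[X in `|X - _|]mul1r -mulrBl normrM ger0_norm ?subr_ge0//.
  apply: le_trans (ler_wpM2l _ (KL i)) _; first by rewrite subr_ge0.
  by rewrite -/r -/P mulrBl uPr; lra.
- move=> i; rewrite /= mxE addrAC subrr add0r normrM ger0_norm//.
  by rewrite -uPr; exact: ler_wpM2l (KL i).
Qed.

(** End of the chain: the half cube of [K] and [Q] both have volume comparable to that of [Q^**], so
    one move inside [Q^**] leads to the bump on [Q], a multiple of an atom. *)
Lemma decomposes_half_bump_last K Q : QQ Q -> cube_set K `<=` cube_set Q^** ->
  (radius Q^**)%:num <= 2 * (radius K)%:num ->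
  decomposes AA chain_step (bump w (half_cube K)).
Proof.
move=> QQQ KQ PK.
have th0 : 0 < theta%:num by [].
have rK0 : 0 < (radius K)%:num by [].
have rQ0 : 0 < (radius Q)%:num by [].
have -> : bump w (half_cube K) =
   (fun x => (bump w (half_cube K) x + -1 * bump w Q x) + 1 * bump w Q x).
  by apply/funext => x; rewrite mulN1r mul1r addrNK.
have -> : chain_step = 2 * chain_ratio / delta + normc (1 : R[i]) * delta^-1.
  by rewrite Normc.normc1 /chain_step; field; rewrite gt_eqF.
apply: decomposesD; last first.
  by apply: decomposesZ; exact: (decomposes_bump delta_gt0 mw w_bounds).
apply: (decomposes_bumpB delta_gt0 mw w_bounds (Q := Q) (L := Q^**)) => //.
- exact: subset_trans (@closure_half_cube _ _ _) KQ.
- exact: closure_cube_star2.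
- by apply: le_volume; move: PK; rewrite radius_star2 /=; nra.
- by apply: le_volume; rewrite radius_star2 /=; nra.
Qed.

Lemma ratio_powR_ge1 K Q : cube_set K `<=` cube_set Q^** ->
  1 <= ((radius Q^**)%:num / (radius K)%:num) `^ lambda.
Proof.
move=> KQ; have : 1 <= (radius Q^**)%:num / (radius K)%:num.
  by rewrite ler_pdivlMr// mul1r; exact: radius_le_star2.
by move=> h; rewrite -[leLHS](powRr0 ((radius Q^**)%:num / (radius K)%:num)) ler_powR// ltW.
Qed.

Lemma chain_costE : chain_cost * (1 - 2 `^ (- lambda)) = chain_step.
Proof. by rewrite /chain_cost mulfVK// gt_eqF// subr_gt0 pow2N_lt1. Qed.

(** Puts the cost of the last move in the form carried by the induction; the power of the ratio of
    radii is at least 1. *)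
Lemma decomposes_half_bump_early K Q : QQ Q -> cube_set K `<=` cube_set Q^** ->
  (radius Q^**)%:num <= 2 * (radius K)%:num ->
  decomposes AA
    (chain_cost * ((radius Q^**)%:num / (radius K)%:num) `^ lambda)
    (bump w (half_cube K)).
Proof.
move=> QQQ KQ PK; apply: decomposes_le (decomposes_half_bump_last QQQ KQ PK).
have := ratio_powR_ge1 KQ; set p := _ `^ lambda => p1.
have cc0 := chain_cost_gt0; have : 0 <= 2 `^ (- lambda) :> R := powR_ge0 _ _.
by rewrite -chain_costE; set q := _ `^ _ => q0; nra.
Qed.

(** Induction on a bound [N] for the number of doublings. The cost is uniform in [N]: doubling [K]
    divides the power of the ratio by [2 ^ lambda], and the decrease pays for the move. *)
Lemma decomposes_half_bump N K Q : QQ Q -> cube_set K `<=` cube_set Q^** ->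
  (radius Q^**)%:num <= 2 ^+ N.+1 * (radius K)%:num ->
  decomposes AA
    (chain_cost * ((radius Q^**)%:num / (radius K)%:num) `^ lambda)
    (bump w (half_cube K)).
Proof.
move=> QQQ; elim: N K => [|N IH] K KQ PK; have rK0 : 0 < (radius K)%:num by [];
  have cc0 := chain_cost_gt0;
  have [P2K|P2K] := leP (radius Q^**)%:num (2 * (radius K)%:num).
- exact: decomposes_half_bump_early.
- by move: PK; rewrite expr1 leNgt P2K.
- exact: decomposes_half_bump_early.
have [K' [rK' K'Q cK']] := double_cube KQ (ltW P2K).
have -> : bump w (half_cube K) = (fun x =>
   (bump w (half_cube K) x + -1 * bump w (half_cube K') x)
   + 1 * bump w (half_cube K') x).
  by apply/funext => x; rewrite mulN1r mul1r addrNK.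
apply: (@decomposes_le _ _ _ (2 * chain_ratio / delta + normc (1 : R[i]) *
    (chain_cost * ((radius Q^**)%:num / (radius K')%:num) `^ lambda))).
  have -> : (radius Q^**)%:num / (radius K')%:num =
      2^-1 * ((radius Q^**)%:num / (radius K)%:num).
    by rewrite rK'; field; rewrite gt_eqF.
  rewrite powRM// -(powR_inv1 (ler0n R 2)) -powRrM mulN1r Normc.normc1 mul1r.
  have : 2 * chain_ratio / delta <= chain_step.
    by rewrite /chain_step ler_pM2r ?invr_gt0//; lra.
  have := ratio_powR_ge1 KQ; set p := _ `^ lambda => p1.
  rewrite -chain_costE; have := pow2N_lt1; set q := _ `^ _ => q1 h.
  (* As [chain_step = chain_cost * (1 - q)], the inequality [chain_step + chain_cost * q * p <=
     chain_cost * p] says that this product is nonnegative. *)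
  have : 0 <= chain_cost * (1 - q) * (p - 1).
    by apply: mulr_ge0; [apply: mulr_ge0|]; lra.
  by move: h; rewrite !mulrA; lra.
apply: decomposesD; last first.
  by apply/decomposesZ/IH => //; rewrite rK' mulrA -exprSr.
apply: (decomposes_bumpB delta_gt0 mw w_bounds (Q := Q) (L := K')) => //.
(* The centre has moved by at most the radius of [K], less than the available margin of [3 / 2] of
   that radius. *)
- apply: closure_cube_sub => i; rewrite /= rK'.
  by have := cK' i; lra.
- exact: closure_half_cube.
- by apply: le_volume; rewrite rK' /=; have : 0 < theta%:num by []; nra.
- by apply: le_volume; rewrite /= rK'; have : 0 < theta%:num by []; nra.
Qed.

End chain.

(** * Norms and moments of atoms *)

Section atom_norm.
Local Open Scope complex_scope.
Variables (R : realType) (d : nat).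
Implicit Types (K L Q : cube R d) (f a : 'rV[R]_d -> R[i]).
Local Notation mu := (lebesgue_rV d : {measure set 'rV[R]_d -> \bar R}).

(** Comparison almost everywhere with the normalised indicator of [K], whose integral is 1. *)
Lemma L1norm_cube_le f K : measurableC f -> supp f `<=` cube_set K ->
  (\forall x \ae mu, normc (f x) <= (volume K)^-1) -> (L1norm f <= 1)%E.
Proof.
move=> mf fK fb; have mK := measurable_cube K.
have vK := volume_gt0 K.
have -> : 1%E = (\int[mu]_x ((volume K)^-1%:E * (\1_(cube_set K) x)%:E))%E.
  rewrite ge0_integralZl//=.
  - by rewrite integral_indic// setIT lebesgue_cube -EFinM mulVf ?gt_eqF.
  - by apply/measurable_EFinP; exact: measurable_indic.
  - by rewrite lee_fin invr_ge0 ltW.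
apply: ae_ge0_le_integral => //=.
- by move=> x _; rewrite lee_fin normc_ge0.
- by apply/measurable_EFinP; exact: measurable_normc.
- by move=> x _; rewrite lee_fin mulr_ge0// invr_ge0 ltW.
- apply/measurable_EFinP; apply: measurable_funM => //.
apply: filterS fb => x fb _; rewrite lee_fin indicE.
have [xK|/negP xK] := boolP (x \in cube_set K); first by rewrite mulr1.
have [->|fx] := eqVneq (f x) 0; first by rewrite Normc.normc0 mulr0.
by exfalso; apply: xK; apply/mem_set/fK; exact: subset_closure.
Qed.

Lemma L1norm_atom c theta QQ a : atoms_with c theta QQ a -> (L1norm a <= 1)%E.
Proof.
move=> [La [[Q _ [K [_ aK /ess_supP ab _]]]|[Q _ aE]]].
  apply: (@L1norm_cube_le _ K) => //; first by case: La.
  apply: filterS ab => x; rewrite lebesgue_cube inver gt_eqF ?volume_gt0//.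
have vQ := volume_gt0 Q.
rewrite /L1norm aE; under eq_integral do rewrite normc_real ger0_norm ?mulr_ge0
  ?lebesgue_cube ?invr_ge0 ?(ltW (volume_gt0 Q))// EFinM.
rewrite ge0_integralZl//=.
- rewrite integral_indic//; last exact: measurable_cube.
  by rewrite setIT lebesgue_cube -EFinM mulVf ?gt_eqF.
- by apply/measurable_EFinP; apply: measurable_indic; exact: measurable_cube.
- by rewrite lee_fin invr_ge0 ltW.
Qed.

(** The duality bound between integrable and bounded functions, with the factor 2 of
    [normc_integralC]. *)
Lemma normc_integralC_le f (v : 'rV[R]_d -> R) K (h : R) :
  L1 f -> (L1norm f <= 1)%E -> L1 (fun x => f x * (v x)%:C) -> 0 <= h ->
  (forall x, cube_set K x -> `|v x| <= h) ->
  normc (integralC (cube_set K) (fun x => f x * (v x)%:C)) <= 2 * h.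
Proof.
move=> Lf f1 Lfv h0 vh; have mK := measurable_cube K; rewrite -lee_fin.
apply: le_trans (normc_integralC mK Lfv) _.
rewrite EFinM lee_pmul2l//.
have mn : measurable_fun setT (fun x => (normc (f x))%:E).
  by apply/measurable_EFinP; apply: measurable_normc; case: Lf.
apply: (@le_trans _ _ (\int[mu]_(x in cube_set K) (h%:E * (normc (f x))%:E))%E).
  apply: ge0_le_integral => //=.
  - by move=> x _; rewrite lee_fin normc_ge0.
  - by apply/measurable_EFinP/measurable_funTS; apply: measurable_normc; case: Lfv.
  - by apply/measurable_EFinP/measurable_funTS; apply: measurable_funM => //;
      apply: measurable_normc; case: Lf.
  - move=> x Kx; rewrite lee_fin Normc.normcM normc_real mulrC.
    by rewrite ler_wpM2r ?normc_ge0// vh.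
rewrite ge0_integralZl//=; last 2 first.
- exact: measurable_funTS.
- by move=> x _; rewrite lee_fin normc_ge0.
rewrite -[leRHS]mule1 lee_wpmul2l// (le_trans _ f1)//.
by apply: ge0_subset_integral => //= x _; rewrite lee_fin normc_ge0.
Qed.

End atom_norm.

(** The Euclidean norm is at most [Num.sqrt d] times the sup norm, and [diam Q] contains the same
    factor. *)
Lemma euclid_diam_le (R : realType) d (K Q : cube R d) x : (0 < d)%N ->
  cube_set K x ->
  euclid (x - center K) / diam Q <= (radius K)%:num / (radius Q)%:num.
Proof.
move=> d0 /cube_setP Kx; have rK : 0 < (radius K)%:num by [].
have sd : 0 < Num.sqrt d%:R :> R by rewrite sqrtr_gt0 ltr0n.
have : euclid (x - center K) <= Num.sqrt d%:R * (radius K)%:num.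
  rewrite -[X in _ * X]gtr0_norm// -sqrtr_sqr -sqrtrM ?ler0n//.
  rewrite ler_sqrt ?mulr_ge0 ?sqr_ge0//.
  rewrite (@le_trans _ _ (\sum_(i < d) (radius K)%:num ^+ 2))//.
    apply: ler_sum => i _; rewrite !mxE -[(x ord0 i - _) ^+ 2]real_normK ?num_real//.
    by rewrite lerXn2r ?nnegrE// distrC ltW.
  by rewrite sumr_const card_ord mulr_natl.
move=> h; rewrite /diam ler_pdivrMr ?mulr_gt0//.
rewrite (le_trans h)// (_ : _ / _ * _ = 2 * (Num.sqrt d%:R * (radius K)%:num)).
  by rewrite ler_peMl ?ler1n// mulr_ge0// ltW.
by field; rewrite gt_eqF.
Qed.

(** * Atoms of one weight in terms of atoms of another *)

Section change_of_weight.
Local Open Scope complex_scope.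
Variables (R : realType) (d : nat) (delta lambda C : R) (w1 w2 : 'rV[R]_d -> R).
Hypotheses (delta_gt0 : 0 < delta) (lambda_gt0 : 0 < lambda) (C_ge0 : 0 <= C).
Hypothesis d_gt0 : (0 < d)%N.
Variables (theta : {posnum R}) (QQ : set (cube R d)).
Hypotheses (mw1 : measurable_fun setT w1) (mw2 : measurable_fun setT w2).
Hypothesis w1_bounds : forall x, delta <= w1 x <= 1.
Hypothesis w2_bounds : forall x, delta <= w2 x <= 1.
Implicit Types (K L Q : cube R d) (f a : 'rV[R]_d -> R[i]).
Local Notation "Q ^**" := (iter 2 (star theta) Q) (at level 2).

Definition holder (w : 'rV[R]_d -> R) := forall Q, QQ Q -> forall x y,
  cube_set Q^** x -> cube_set Q^** y ->
  `|w x - w y| <= C * (euclid (x - y) / diam Q) `^ lambda.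

Hypotheses (holder1 : holder w1) (holder2 : holder w2).

Lemma holder_cube w K Q x : holder w -> QQ Q -> cube_set K `<=` cube_set Q^** ->
  cube_set K x -> `|w x - w (center K)| <=
    C * ((radius K)%:num / (radius Q)%:num) `^ lambda.
Proof.
move=> hw QQQ KQ Kx; have := hw Q QQQ x (center K) (KQ _ Kx) (KQ _ (cube_center K)).
move=> /le_trans; apply; rewrite ler_wpM2l//.
apply: ge0_ler_powR; rewrite ?nnegrE//; first exact: ltW.
- by rewrite divr_ge0 ?mulr_ge0 ?sqrtr_ge0.
- exact: euclid_diam_le.
Qed.

(* On [K], [w2] is a multiple of [w1] up to an error of size [(r_K / r_Q) ^ lambda]. *)
Lemma moment_change a K Q : QQ Q -> cube_set K `<=` cube_set Q^** ->
  L1 a -> (L1norm a <= 1)%E -> moment w1 K a = 0 ->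
  normc (moment w2 K a) <= 2 * ((1 + delta^-1) *
    (C * ((radius K)%:num / (radius Q)%:num) `^ lambda)).
Proof.
move=> QQQ KQ La a1 a0; set e := C * _.
have e0 : 0 <= e by rewrite mulr_ge0// powR_ge0.
(* With this [k] the function [w2 - k * w1] vanishes at the centre of [K], and subtracting [k * w1]
   leaves the moment unchanged because the [w1]-moment of [a] is 0. *)
pose k := w2 (center K) / w1 (center K).
have w1c : 0 < w1 (center K) := weight_gt0 delta_gt0 w1_bounds _.
have w2c : 0 < w2 (center K) := weight_gt0 delta_gt0 w2_bounds _.
have L1a := L1M_bounded mw1 (weight_norm_le1 delta_gt0 w1_bounds) La.
have L2a := L1M_bounded mw2 (weight_norm_le1 delta_gt0 w2_bounds) La.
have vE : (fun x => a x * (w2 x - k * w1 x)%:C) =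
    (fun x => a x * (w2 x)%:C + (- k%:C) * (a x * (w1 x)%:C)).
  by apply/funext => x; rewrite rmorphB rmorphM/= mulrBr mulNr mulrCA.
have -> : moment w2 K a = integralC (cube_set K) (fun x => a x * (w2 x - k * w1 x)%:C).
  have mK := measurable_cube K.
  rewrite vE integralCD//; last exact: L1Z.
  rewrite integralCZ// -[X in _ = _ + _ * X]/(moment w1 K a).
  by rewrite a0 mulr0 addr0.
apply: normc_integralC_le => //.
- by rewrite vE; apply: L1D => //; exact: L1Z.
- by rewrite mulr_ge0// addr_ge0// invr_ge0 ltW.
move=> x Kx.
have -> : w2 x - k * w1 x =
    (w2 x - w2 (center K)) - k * (w1 x - w1 (center K)).
  by rewrite /k; field; rewrite gt_eqF.
apply: le_trans (ler_normB _ _) _; rewrite mulrDl mul1r.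
apply: lerD; first exact: holder_cube.
rewrite normrM ler_pM//; last exact: holder_cube.
rewrite ger0_norm; last by rewrite divr_ge0// ltW.
have /andP[_ w21] := w2_bounds (center K); have /andP[dw1 _] := w1_bounds (center K).
rewrite -[leRHS]mul1r ler_pM ?invr_ge0//; [exact: ltW|exact: ltW|].
by rewrite lef_pV2 ?posrE.
Qed.

(** The first two terms pay for the atom corrected by a bump. The last one is the bound on its
    moment times the chain cost, after the powers of the radii have been combined. The weights enter
    only through [delta], [lambda] and [C], so the constant serves in both directions. *)
Definition change_cost : R := 1 + 2 * 2 ^+ d / delta + 2 * (1 + delta^-1) * C *
  chain_cost d delta lambda theta * ((1 + theta%:num) ^+ 2) `^ lambda.

Lemma change_cost_ge1 : 1 <= change_cost.
Proof.
have cc0 := chain_cost_gt0 d delta_gt0 lambda_gt0 theta.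
have di0 : 0 <= delta^-1 by rewrite invr_ge0 ltW.
rewrite /change_cost -addrA lerDl; apply: addr_ge0; first exact: mulr_ge0.
apply: mulr_ge0 (powR_ge0 _ _); apply: mulr_ge0 (ltW cc0).
by apply: mulr_ge0 C_ge0; apply: mulr_ge0 => //; exact: addr_ge0.
Qed.

Lemma decomposes_atom a : atoms_weighted w1 theta QQ a ->
  decomposes (atoms_weighted w2 theta QQ) change_cost a.
Proof.
move=> Aa; have a1 := L1norm_atom Aa.
case: Aa => La [[Q QQQ [K [KQ aK /ess_supP ab a0]]]|hQ]; last first.
  (* Indicator atoms are the same for all weights. *)
  have -> : a = fun x => 1 * a x by apply/funext => x; rewrite mul1r.
  apply: decomposes_le (decomposes1 _ _).
    by rewrite Normc.normc1; exact: change_cost_ge1.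
  by split => //; right.
have vK := volume_gt0 K; have vhK := volume_gt0 (half_cube K).
set c := moment w2 K a.
have Lb := L1_bump w2 (half_cube K).
have c_le := moment_change QQQ KQ La a1 a0.
(* This crude bound controls the size of the corrected atom; the finer [c_le] is kept for the cost
   of the chain. *)
have c2 : normc c <= 2.
  rewrite -[leRHS]mulr1; apply: normc_integralC_le => //.
  - exact: L1M_bounded mw2 (weight_norm_le1 delta_gt0 w2_bounds) La.
  - by move=> x _; exact: weight_norm_le1 delta_gt0 w2_bounds x.
have -> : a = fun x => (a x + - c * bump w2 (half_cube K) x) +
    c * bump w2 (half_cube K) x.
  by apply/funext => x; rewrite mulNr addrNK.
(* Enough doublings exist because powers of 2 exceed their exponents. *)
have [N PN] : exists N, (radius Q^**)%:num <= 2 ^+ N.+1 * (radius K)%:num.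
  have : 0 <= (radius Q^**)%:num / (radius K)%:num by [].
  move=> /archi_boundP; set N := Num.bound _ => hN; exists N.
  rewrite -ler_pdivrMr// (le_trans (ltW hN))//.
  by rewrite -natrX ler_nat ltnW// ltnW// ltn_expl.
have tail := decomposesZ c (decomposes_half_bump delta_gt0 mw2 w2_bounds
  lambda_gt0 d_gt0 QQQ KQ PN).
apply: decomposes_le (decomposesD _ tail); last first.
  apply: (decomposes_cancelling (B := 1 + 2 * 2 ^+ d / delta)
    delta_gt0 mw2 w2_bounds QQQ KQ) => //.
  - by rewrite addr_gt0// !mulr_gt0// ?exprn_gt0// invr_gt0.
  - by apply: L1D => //; exact: L1Z.
  - apply: (@subset_trans _ (closure ([set x | a x != 0] `|` cube_set (half_cube K)))).
      apply: closure_subset => x /= ne0.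
      have [|/negPn/eqP ax0] := boolP (a x != 0); first by left.
      right; apply: (@bump_neq0 _ _ w2) => /=; apply: contra_neq ne0 => b0.
      by rewrite b0 ax0 mulr0 addr0.
    by rewrite closureU subUset; split => //; exact: closure_half_cube.
  - apply: filterS ab => x; rewrite lebesgue_cube inver gt_eqF// lee_fin => ax.
    apply: le_trans (ler_normcD _ _) _; rewrite mulrDl mul1r lerD//.
    rewrite Normc.normcM normc_oppr.
    have := normc_bump_le delta_gt0 mw2 w2_bounds (half_cube K) x.
    move=> /(ler_pM (normc_ge0 _) (normc_ge0 _) c2)/le_trans; apply.
    by rewrite (volume_half K) le_eqVlt; apply/orP; left; apply/eqP; field;
      rewrite !gt_eqF// exprn_gt0.
  - rewrite (momentD delta_gt0 mw2 w2_bounds)//; last exact: L1Z.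
    rewrite (momentZ delta_gt0 mw2 w2_bounds)//.
    rewrite (moment_bump delta_gt0 mw2 w2_bounds) ?mulr1 ?subrr//.
    exact: subset_trans (@subset_closure _ _) (@closure_half_cube _ _ K).
rewrite lerD2l.
have cc0 := chain_cost_gt0 d delta_gt0 lambda_gt0 theta.
apply: le_trans (ler_wpM2r _ c_le) _; first by rewrite mulr_ge0 ?powR_ge0// ltW.
(* The smallness of the moment compensates the chain cost: the radius of [K] cancels. *)
have -> : ((1 + theta%:num) ^+ 2) `^ lambda =
    ((radius K)%:num / (radius Q)%:num) `^ lambda *
    ((radius Q^**)%:num / (radius K)%:num) `^ lambda.
  by rewrite -powRM// radius_star2; congr (_ `^ _); field; rewrite !gt_eqF.
by rewrite le_eqVlt; apply/orP; left; apply/eqP; ring.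
Qed.

End change_of_weight.

(** * Regrouping and expanding atomic series *)

Section atomic_series.
Local Open Scope complex_scope.
Variables (R : realType) (d : nat).
Implicit Types (f : 'rV[R]_d -> R[i]) (c : nat -> R[i]) (b : nat -> 'rV[R]_d -> R[i]).

Definition remainder f c b n (x : 'rV[R]_d) : R[i] :=
  f x - \sum_(0 <= j < n) c j * b j x.

Lemma L1_remainder f c b n : L1 f -> (forall j, L1 (b j)) -> L1 (remainder f c b n).
Proof.
move=> Lf Lb; have -> : remainder f c b n =
    fun x => f x + -1 * \sum_(j <- index_iota 0 n) c j * b j x.
  by apply/funext => x; rewrite mulN1r.
by apply: L1D => //; apply: L1Z; apply: L1_sum => j; exact: L1Z.
Qed.

Lemma L1norm_remainder_le f c b m n : (m <= n)%N -> L1 f ->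
  (forall j, L1 (b j)) -> (forall j, (L1norm (b j) <= 1)%E) ->
  (L1norm (remainder f c b m) <=
   L1norm (remainder f c b n) + (\sum_(m <= j < n) normc (c j))%:E)%E.
Proof.
move=> mn Lf Lb b1; have {mn} := subnKC mn; move: (n - m)%N => k <- {n}.
elim: k => [|k IH]; first by rewrite addn0 big_geq// adde0.
apply: le_trans IH _; rewrite addnS big_nat_recr ?leq_addr//= EFinD.
rewrite addeA addeAC; apply: leeD2r.
have -> : remainder f c b (m + k) = fun x => remainder f c b (m + k).+1 x +
    c (m + k)%N * b (m + k)%N x.
  by apply/funext => x; rewrite /remainder big_nat_recr//= opprD addrA addrNK.
have [mr _] := L1_remainder c (m + k).+1 Lf Lb.
have [mb _] := L1Z (c (m + k)%N) (Lb (m + k)%N).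
apply: le_trans (L1normD mr mb) _; apply: leeD2l.
rewrite L1normZ; last by case: (Lb (m + k)%N).
by rewrite -[leRHS]mule1 lee_wpmul2l ?lee_fin ?normc_ge0.
Qed.

(** Expanding a series term by term gives convergence only along the ends of blocks; summability of
    the coefficients extends it to all partial sums. *)
Lemma cvg_remainder_subseq f c b (s : nat -> nat) (S : R) : L1 f ->
  (forall j, L1 (b j)) -> (forall j, (L1norm (b j) <= 1)%E) ->
  (forall n, \sum_(0 <= j < n) normc (c j) <= S) ->
  (forall k, (k <= s k)%N) ->
  L1norm (remainder f c b (s k)) @[k --> \oo] --> 0%E ->
  L1norm (remainder f c b n) @[n --> \oo] --> 0%E.
Proof.
move=> Lf Lb b1 cS sk cvgs.
pose u n : R := \sum_(0 <= j < n) normc (c j).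
have u_nd : nondecreasing_seq u.
  apply/nondecreasing_seqP => n; rewrite /u big_nat_recr//= lerDl.
  exact: normc_ge0.
have cvgu : cvgn u.
  by apply: nondecreasing_is_cvgn => //; exists S => _ [n _ <-]; exact: cS.
have uU n : u n <= limn u by exact: nondecreasing_cvgn_le.
(* Compare the remainder at [m] with that at [s k], then let [k] tend to infinity: only the tail of
   the coefficients is left. *)
have tail m : (L1norm (remainder f c b m) <= (limn u - u m)%:E)%E.
  have cvgs' : (L1norm (remainder f c b (s k)) + (limn u - u m)%:E)%E
      @[k --> \oo] --> (0 + (limn u - u m)%:E)%E.
    by apply: cvgeD => //; exact: cvg_cst.
  rewrite -[leRHS]add0e -(cvg_lim _ cvgs')//.
  apply: lime_ge; first by apply/cvg_ex; exists (0 + (limn u - u m)%:E)%E.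
  near=> k; have mk : (m <= s k)%N.
    by apply: leq_trans (sk k); near: k; exact: nbhs_infty_ge.
  apply: le_trans (L1norm_remainder_le c mk Lf Lb b1) _.
  apply: leeD2l; rewrite lee_fin lerBrDl.
  by rewrite -big_cat_nat//=; exact: uU.
apply: (@squeeze_cvge _ _ _ _ (cst 0%E) _ (fun m => (limn u - u m)%:E)).
- by apply: nearW => m; rewrite L1norm_ge0 tail.
- exact: cvg_cst.
- have -> : 0%E = (limn u - limn u)%:E :> \bar R by rewrite subrr.
  apply: cvg_EFin; first exact: nearW.
  by apply: cvgB => //; exact: cvg_cst.
Unshelve. all: by end_near. Qed.

(** In any representation over [A] each atom is replaced by its finite combination over [A'].
    Concatenating these combinations gives a representation over [A'] whose coefficient sum is at
    most [M] times larger. *)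
Lemma H1at_norm_le (A A' : set ('rV[R]_d -> R[i])) (M : R) f : 0 < M ->
  (forall a, A' a -> L1 a /\ (L1norm a <= 1)%E) ->
  (forall a, A a -> decomposes A' M a) -> L1 f ->
  (H1at_norm A' f <= M%:E * H1at_norm A f)%E.
Proof.
move=> M0 A'L AA' Lf; rewrite -lee_pdivrMl//; apply/ereal_infP.
move=> _ [lam [a [Aa -> lamfin cvga]]]; rewrite lee_pdivrMl//.
have /choice[l ldec] : forall j, exists l : seq (R[i] * ('rV[R]_d -> R[i])),
    [/\ l != [::], (forall p, p \in l -> A' p.2),
      \sum_(p <- l) normc p.1 <= normc (lam j) * M &
      (fun x => lam j * a j x) = fun x => \sum_(p <- l) p.1 * p.2 x].
  by move=> j; exact: decomposesZ (AA' _ (Aa j)).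
pose L n := flatten [seq l j | j <- iota 0 n].
have LS n : L n.+1 = L n ++ l n.
  by rewrite /L -[n.+1]addn1 iotaD map_cat flatten_cat /= cats0.
have sL n : (n <= size (L n))%N.
  elim: n => // n IH; rewrite LS size_cat -addn1 leq_add//.
  by have [] := ldec n; case: (l n).
have LA n p : p \in L n -> A' p.2.
  move=> /flatten_mapP[j _]; have [_ + _ _] := ldec j; exact.
(* The entry of index [m] is already present in [L m.+1] by [sL], so the default value is never
   read; later lists only extend earlier ones. *)
pose e m := nth (0, a 0%N) (L m.+1) m.
have nthL n k m : (m < size (L n))%N -> nth (0, a 0%N) (L (n + k)%N) m =
    nth (0, a 0%N) (L n) m.
  move=> mn; elim: k => [|k <-]; first by rewrite addn0.
  rewrite addnS LS nth_cat ifT// (leq_trans mn)//.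
  by elim: (k) => [|i IH]; rewrite ?addn0// addnS LS size_cat (leq_trans IH)// leq_addr.
have eL n m : (m < size (L n))%N -> e m = nth (0, a 0%N) (L n) m.
  move=> mn; rewrite /e; have [nm|mn'] := leqP n m.+1.
    by rewrite -(subnKC nm) nthL.
  by rewrite -(subnKC (ltnW mn')) nthL.
have sumL (V : nmodType) (F : R[i] * ('rV[R]_d -> R[i]) -> V) n :
    \sum_(0 <= j < size (L n)) F (e j) = \sum_(p <- L n) F p.
  rewrite [RHS](big_nth (0, a 0%N)).
  by apply: eq_big_nat => j /andP[_ jn]; rewrite (eL n).
have sum_flat (V : nmodType) (F : R[i] * ('rV[R]_d -> R[i]) -> V) n :
    \sum_(p <- L n) F p = \sum_(0 <= j < n) \sum_(p <- l j) F p.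
  by rewrite big_flatten big_map /index_iota subn0.
have eA m : A' (e m).2 by apply: (LA m.+1); rewrite mem_nth// sL.
have S_fin : (\sum_(0 <= j <oo) (normc (lam j))%:E)%E \is a fin_num.
  rewrite ge0_fin_numE//; apply: nneseries_ge0 => j _ _.
  by rewrite lee_fin normc_ge0.
set S := (\sum_(0 <= j <oo) _)%E in lamfin S_fin *.
have e_le n : \sum_(0 <= j < n) normc (e j).1 <= M * fine S.
  (* A partial sum may stop inside a block, so it is first enlarged to [n] full blocks. *)
  apply: (@le_trans _ _ (\sum_(0 <= j < size (L n)) normc (e j).1)).
    rewrite [leRHS](@big_cat_nat _ _ _ n)//= lerDl.
    by apply: sumr_ge0 => j _; exact: normc_ge0.
  rewrite (sumL _ (fun p => normc p.1)) sum_flat.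
  apply: (@le_trans _ _ (\sum_(0 <= j < n) normc (lam j) * M)).
    by apply: ler_sum => j _; have [] := ldec j.
  rewrite -mulr_suml mulrC; apply: (ler_wpM2l (ltW M0)); rewrite -lee_fin fineK//.
  rewrite -sumEFin; apply: nneseries_lim_ge => j _ _.
  by rewrite lee_fin normc_ge0.
have cle : (\sum_(0 <= j <oo) (normc (e j).1)%:E <= M%:E * S)%E.
  rewrite -(fineK S_fin) -EFinM; apply: lime_le.
    by apply: is_cvg_nneseries => j _ _; rewrite lee_fin normc_ge0.
  by apply: nearW => n; rewrite sumEFin lee_fin.
apply: (le_trans _ cle); apply: ereal_inf_lbound.
exists (fun j => (e j).1), (fun j => (e j).2); split => //.
- by apply: (le_lt_trans cle); rewrite -(fineK S_fin) -EFinM ltry.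
- have eL1 j := (A'L _ (eA j)).1; have e1 j := (A'L _ (eA j)).2.
  apply: (cvg_remainder_subseq (s := fun k => size (L k)) Lf eL1 e1 e_le sL).
  (* At the end of the first [n] blocks, the new remainder is the old one after [n] terms. *)
  apply: cvg_trans cvga; apply: near_eq_cvg; apply: nearW => n.
  congr (L1norm _); apply/funext => x; rewrite /remainder; congr (_ - _).
  rewrite (sumL _ (fun p => p.1 * p.2 x)) sum_flat; apply: eq_bigr => j _.
  by have [_ _ _ /(congr1 (@^~ x))] := ldec j.
Qed.

End atomic_series.

(** * Measurability of the weight *)

Section holder_measurable.
Variables (R : realType) (d : nat) (lambda C : R) (w : 'rV[R]_d -> R).
Hypotheses (lambda_gt0 : 0 < lambda) (C_gt0 : 0 < C) (d_gt0 : (0 < d)%N).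
Variables (theta : {posnum R}) (QQ : set (cube R d)).

(** The closures of the cubes cover the space and each lies in the open [Q^**], where [w] is
    continuous; hence a superlevel set contains a cube around each of its points. *)
Lemma holder_measurable : \bigcup_(Q in QQ) closure (cube_set Q) = setT ->
  holder lambda C theta QQ w -> measurable_fun setT w.
Proof.
move=> QT hw; apply: (measurability _ (RGenOInfty.measurableE R)) => _ [_ [t ->]] <-.
rewrite setTI; apply: measurable_of_cubes => x /=; rewrite in_itv/= andbT => tx.
have [Q QQQ Qx] : (\bigcup_(Q in QQ) closure (cube_set Q)) x by rewrite QT.
have rQ0 : 0 < (radius Q)%:num by [].
pose r := (radius (iter 2 (star theta) Q))%:num - (radius Q)%:num.
have r0 : 0 < r.
  by rewrite /r radius_star2; have : 0 < theta%:num by []; nra.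
(* Chosen so that [(q / r_Q) ^ lambda = (w x - t) / (C + 1)]; the oscillation is then at most
   [C / (C + 1)] of [w x - t], strictly less than the gap. *)
pose q : R := (radius Q)%:num * ((w x - t) / (C + 1)) `^ lambda^-1.
have q0 : 0 < q.
  by rewrite mulr_gt0// powR_gt0// divr_gt0 ?subr_gt0// addr_gt0.
have e0 : 0 < Num.min r q by rewrite lt_min r0.
exists (PosNum e0); set K := Cube x _ => y Ky.
have KQ : cube_set K `<=` cube_set (iter 2 (star theta) Q).
  apply: cube_sub => i; apply: le_trans (closure_cubeP Qx i) _.
  have : Num.min r q <= r by rewrite ge_min lexx.
  by rewrite {2}/r lerBrDl addrC -lerBrDl.
have := holder_cube lambda_gt0 (ltW C_gt0) d_gt0 hw QQQ KQ Ky.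
have : ((radius K)%:num / (radius Q)%:num) `^ lambda <= (w x - t) / (C + 1).
  have b0 : 0 <= (w x - t) / (C + 1) by rewrite divr_ge0 ?subr_ge0 ?ltW// addr_gt0.
  rewrite -[leRHS](powRr1 b0).
  rewrite -[X in _ <= _ `^ X](mulVf (negbT (gt_eqF lambda_gt0))) powRrM.
  apply: ge0_ler_powR; rewrite ?nnegrE ?powR_ge0//; first exact: ltW.
  by rewrite ler_pdivrMr// mulrC /= ge_min lexx orbT.
move=> h1 h2; rewrite /= in_itv/= andbT.
have : C * ((w x - t) / (C + 1)) < w x - t.
  by rewrite mulrA ltr_pdivrMr ?addr_gt0// mulrC ltr_pM2l ?subr_gt0// ltrDl.
have := ler_wpM2l (ltW C_gt0) h1; move: h2; rewrite ler_distl => /andP[h2 _].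
by move: h2; rewrite /=; lra.
Qed.

End holder_measurable.

(** * Equivalence of the two atomic norms *)

Theorem theorem2 (R : realType) (d : nat) (hd : (3 <= d)%N)
  (omega : 'rV[R]_d -> R) (delta : R) (hdelta : 0 < delta)
  (homega : forall x, delta <= omega x <= 1)
  (theta : {posnum R}) (QQ : set (cube R d)) (hG : condition_G theta QQ)
  (lambda C : R) (hlambda : 0 < lambda) (hC : 0 < C)
  (hHolder : forall Q, QQ Q -> forall x y,
     cube_set (iter 2 (star theta) Q) x -> cube_set (iter 2 (star theta) Q) y ->
     `|omega x - omega y| <= C * (euclid (x - y) / diam Q) `^ lambda) :
  exists2 C' : R, 0 < C' & forall f : 'rV[R]_d -> R[i], L1 f ->
    ((C'^-1)%:E * H1at_norm (atoms theta QQ) f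
       <= H1at_norm (atoms_weighted omega theta QQ) f
       <= C'%:E * H1at_norm (atoms theta QQ) f)%E.
Proof.
have d_gt0 : (0 < d)%N by apply: leq_trans hd.
have [_ _ [QT _]] := hG.
have momega := holder_measurable hlambda hC d_gt0 QT hHolder.
have delta_le1 : delta <= 1 by have /andP[] := homega 0; exact: le_trans.
(* The unweighted atoms are those of the constant weight 1, which obeys the same bounds since
   [delta <= 1]. *)
pose one : 'rV[R]_d -> R := fun=> 1.
have mone : measurable_fun setT one by exact: measurable_cst.
have one_bounds x : delta <= one x <= 1 by rewrite delta_le1 lexx.
have hone : holder lambda C theta QQ one.
  by move=> Q _ x y _ _; rewrite subrr normr0 mulr_ge0 ?powR_ge0// ltW.
have -> : atoms theta QQ = atoms_weighted one theta QQ.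
  rewrite /atoms /atoms_weighted; congr atoms_with.
  apply/funext => K; apply/funext => a; congr (integralC _ _ = _).
  by apply/funext => x; rewrite mulr1.
have cost_ge1 := change_cost_ge1 d hdelta hlambda (ltW hC) theta.
have cost_gt0 := lt_le_trans ltr01 cost_ge1.
(* Used once in each direction; the lower estimate is the upper one with the weights exchanged. *)
have bound w1 w2 (mw1 : measurable_fun setT w1) (mw2 : measurable_fun setT w2)
    (b1 : forall x, delta <= w1 x <= 1) (b2 : forall x, delta <= w2 x <= 1)
    (h1 : holder lambda C theta QQ w1) (h2 : holder lambda C theta QQ w2) f :
    L1 f -> (H1at_norm (atoms_weighted w2 theta QQ) f <=
      (change_cost d delta lambda C theta)%:E *
      H1at_norm (atoms_weighted w1 theta QQ) f)%E.
  move=> Lf; apply: H1at_norm_le => // a Aa.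
    by split; [case: Aa|exact: L1norm_atom Aa].
  by apply: (decomposes_atom (w1 := w1)) => //; exact: ltW.
exists (change_cost d delta lambda C theta) => // f Lf.
by rewrite lee_pdivrMl// !bound.
Qed.
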